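(* Let $F$ be a number field with ring of integers $\mathcal{O}_F$, let $d\ge3$, and let $f(x)=x^d+Ax^{d-1}+B\in\mathcal{O}_F[x]$ be irreducible over $F$, with splitting field $L$ over $F$. Suppose there exists a prime $\mathfrak{p}$ of $\mathcal{O}_F$ dividing $(B)$ but not $(A)$ such that $\gcd(d-1,v_{\mathfrak{p}}(B))=1$. Then $\mathrm{Gal}(L/F)$ contains a subgroup $H$ acting transitively on $d-1$ of the roots of $f$ and fixing the remaining root. Hence $\mathrm{Gal}(L/F)$ is a doubly transitive subgroup of $S_d$ (acting on the roots of $f$).
   Context: $v_{\mathfrak{p}}$ is the normalized $\mathfrak{p}$-adic valuation. *)

(* Defs.v *)
From HB Require Import structures.
From mathcomp Require Import all_boot all_order all_algebra all_fingroup all_field.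
Set Implicit Arguments. Unset Strict Implicit. Unset Printing Implicit Defensive.
Import Order.TTheory GRing.Theory Num.Theory.
Local Open Scope ring_scope.

Definition is_alg_int (K : fieldType) (x : K) : Prop :=
  exists p : {poly int}, p \is monic /\ root (map_poly (fun z : int => z%:~R) p) x.

Definition is_nonzero_prime_ideal (K : fieldType) (P : K -> Prop) : Prop :=
  [/\ (forall x, P x -> is_alg_int x),
      P 0,
      (forall x y, P x -> P y -> P (x + y)),
      (forall a x, is_alg_int a -> P x -> P (a * x))
    & [/\ ~ P 1,
      (forall a b, is_alg_int a -> is_alg_int b -> P (a * b) -> P a \/ P b)
    & exists x, P x /\ x != 0]].

Fixpoint ideal_pow (K : fieldType) (P : K -> Prop) (n : nat) : K -> Prop :=
  match n with
  | 0 => fun x => is_alg_int x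
  | n'.+1 => fun x => exists s : seq (K * K),
      (forall q, q \in s -> P q.1 /\ ideal_pow P n' q.2) /\
      x = \sum_(q <- s) q.1 * q.2
  end.

Definition pval_eq (K : fieldType) (P : K -> Prop) (x : K) (n : nat) : Prop :=
  ideal_pow P n x /\ ~ ideal_pow P n.+1 x.

(* Main.v *)
Require Import Defs.
From HB Require Import structures.
From mathcomp Require Import boolp classical_sets.
From mathcomp Require Import all_boot all_order all_algebra all_fingroup all_field ring.
Import Order.TTheory GRing.Theory Num.Theory.
Local Open Scope ring_scope.
Set Implicit Arguments. Unset Strict Implicit. Unset Printing Implicit Defensive.

(** Let [Q] be a prime of the ring of integers above [P], [w] its valuation, and [H]
    the decomposition group of [Q]. Modulo [Q], the polynomial is [x^(d-1) (x + A)],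
    so exactly one root [r0] lies outside [Q], and [H] fixes it. Any other root [r]
    satisfies [(d-1) w(r) = w(B)]. The product [x] of the [H]-orbit of [r], of size
    [m], lies in the fixed field of [H], which has the same value group [e Z] as [F];
    since [w(B) = e v_P(B)], [(d-1) w(x) = m w(B)] shows that [d-1] divides
    [m v_P(B)], hence [m], and so the orbit consists of all roots other than [r0].

    The local ring at a prime is shown to be a valuation ring by Seidenberg's descent
    on an integer relation. Its value group is discrete because, with [N] the degree
    over the rationals and [p] the residue characteristic, some power [x^k] with
    [0 < k <= N] has the value of a power of [p]; so [x^(N!)] has the value of
    [p^(w x)] for an integer [w x], which defines a valuation directly. *)

(** * Algebraic integers *)

Section AlgInt.
Context {K : fieldType}.
Implicit Types x y : K.

Lemma alg_intE x : is_alg_int x <-> integralOver (intr : int -> K) x.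
Proof. by split=> [[p [mp rp]] | [p mp rp]]; exists p. Qed.

Lemma alg_int_int (z : int) : is_alg_int (z%:~R : K).
Proof. by apply/alg_intE; exact: integral_id. Qed.

Lemma alg_int0 : is_alg_int (0 : K). Proof. exact: (alg_int_int 0). Qed.
Lemma alg_int1 : is_alg_int (1 : K). Proof. exact: (alg_int_int 1). Qed.

Lemma alg_intN x : is_alg_int x -> is_alg_int (- x).
Proof. by rewrite !alg_intE; exact: integral_opp. Qed.

Lemma alg_intD x y : is_alg_int x -> is_alg_int y -> is_alg_int (x + y).
Proof. by rewrite !alg_intE; exact: integral_add. Qed.

Lemma alg_intB x y : is_alg_int x -> is_alg_int y -> is_alg_int (x - y).
Proof. by rewrite !alg_intE; exact: integral_sub. Qed.

Lemma alg_intM x y : is_alg_int x -> is_alg_int y -> is_alg_int (x * y).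
Proof. by rewrite !alg_intE; exact: integral_mul. Qed.

Lemma alg_intX x n : is_alg_int x -> is_alg_int (x ^+ n).
Proof.
move=> Ox; elim: n => [|n IHn]; first by rewrite expr0; exact: alg_int1.
by rewrite exprS; exact: alg_intM.
Qed.

Lemma alg_int_prod (I : eqType) (r : seq I) (Q : pred I) (G : I -> K) :
  (forall i, i \in r -> Q i -> is_alg_int (G i)) -> is_alg_int (\prod_(i <- r | Q i) G i).
Proof.
move=> OG; rewrite big_seq_cond.
by apply: big_ind => [||i /andP[/OG]]; [exact: alg_int1 | exact: alg_intM | ].
Qed.

Lemma alg_int_sum (I : eqType) (r : seq I) (Q : pred I) (G : I -> K) :
  (forall i, i \in r -> Q i -> is_alg_int (G i)) -> is_alg_int (\sum_(i <- r | Q i) G i).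
Proof.
move=> OG; rewrite big_seq_cond.
by apply: big_ind => [||i /andP[/OG]]; [exact: alg_int0 | exact: alg_intD | ].
Qed.

Lemma alg_int_root_monic (p : {poly K}) x : p \is monic -> root p x ->
  (forall i, is_alg_int p`_i) -> is_alg_int x.
Proof.
move=> mp rp Op; apply/alg_intE; apply: (integral_root_monic mp rp).
by move=> c /(nthP 0)[i _ <-]; apply/alg_intE.
Qed.

Lemma alg_int_horner_int (q : {poly int}) x :
  is_alg_int x -> is_alg_int (map_poly intr q).[x].
Proof.
move=> Ox; rewrite horner_coef; apply: alg_int_sum => i _ _.
by rewrite coef_map; apply: alg_intM; [exact: alg_int_int | exact: alg_intX].
Qed.

(** For positive [n], multiplying the relation by [a n ^+ (n - 1)] turns it into a monic equation
    for [a n * x] with integral coefficients. *)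
Lemma alg_int_leading (n : nat) (a : nat -> K) x : (forall i, is_alg_int (a i)) ->
  \sum_(i < n.+1) a i * x ^+ i = 0 -> is_alg_int (a n * x).
Proof.
move=> Oa; case: n => [|n] a0.
  move: a0; rewrite big_ord1 expr0 mulr1 => ->; rewrite mul0r; exact: alg_int0.
pose q : {poly K} := 'X^(n.+1) + \poly_(i < n.+1) (a i * a n.+1 ^+ (n - i)).
apply: (@alg_int_root_monic q).
- by rewrite monicE lead_coefDl ?lead_coefXn // size_polyXn ltnS size_poly.
- apply/rootP; rewrite hornerD hornerXn horner_poly.
  apply: etrans (_ : a n.+1 ^+ n * (\sum_(i < n.+2) a i * x ^+ i) = _); last first.
    by rewrite a0 mulr0.
  rewrite [in RHS]big_ord_recr /= mulrDr addrC exprMn mulr_sumr; congr (_ + _).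
    apply: eq_bigr => i _; rewrite exprMn.
    have -> : a n.+1 ^+ n = a n.+1 ^+ (n - i) * a n.+1 ^+ i.
      by rewrite -exprD subnK // -ltnS.
    by rewrite [RHS]mulrACA [a i * _]mulrC.
  by rewrite [a _ ^+ n.+1]exprSr -mulrA.
- move=> i; rewrite coefD coefXn coef_poly; apply: alg_intD; first exact: (alg_int_int (i == n.+1)).
  by case: ifP => _; [apply: alg_intM => //; exact: alg_intX | exact: alg_int0].
Qed.
End AlgInt.

(** Integer polynomials are fixed by [phi], which is injective, so one equation serves on both
    sides. It is applied to embeddings and to Galois automorphisms alike. *)
Lemma alg_int_rmorph (K L : fieldType) (phi : {rmorphism K -> L}) x :
  is_alg_int (phi x) <-> is_alg_int x.
Proof.
have e (p : {poly int}) : (map_poly (fun z : int => z%:~R) p : {poly L})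
    = map_poly phi (map_poly (fun z : int => z%:~R) p).
  by rewrite -map_poly_comp; apply: eq_map_poly => z /=; rewrite rmorph_int.
split=> -[p [mp rp]]; exists p; split => //.
  by rewrite e fmorph_root in rp.
by rewrite e fmorph_root.
Qed.

Lemma intr_eq0_ext (K : fieldExtType rat) (z : int) : (z%:~R == 0 :> K) = (z == 0).
Proof.
have -> : z%:~R = in_alg K z%:~R by rewrite rmorph_int.
by rewrite fmorph_eq0 intr_eq0.
Qed.

(** The minimal polynomial over the rationals, cleared of denominators and content. Primitivity
    leaves a coefficient prime to any given prime number; the size bound limits the exponents in
    [loc_unit_power]. *)
Lemma primitive_int_relation (K : fieldExtType rat) (x : K) :
  exists q : {poly int}, [/\ zcontents q = 1, (size q <= (\dim {:K}).+1)%N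
    & root (map_poly intr q) x].
Proof.
have /polyOver1P[r Dr] := minPolyOver 1%AS x.
have [q [a a0 Dq]] := rat_poly_scale r.
have r0 : r != 0.
  apply: contraTneq (monic_minPoly 1%AS x) => r0.
  by rewrite Dr r0 rmorph0 monicE lead_coef0 eq_sym oner_eq0.
have q0 : q != 0.
  by apply: contra_neq r0 => q0; rewrite Dq q0 rmorph0 scaler0.
have szq : size q = size (minPoly 1%AS x).
  rewrite Dr size_map_poly Dq size_scale ?invr_eq0 ?intr_eq0 //.
  by rewrite size_map_poly_id0 // intr_eq0 lead_coef_eq0.
have rq : root (map_poly intr q) x.
  have -> : map_poly intr q = map_poly (in_alg K) (map_poly intr q).
    by rewrite -map_poly_comp; apply: eq_map_poly => z /=; rewrite -[in RHS]in_algE rmorph_int.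
  have := root_minPoly 1%AS x; rewrite Dr Dq /root.
  rewrite map_polyZ hornerZ mulf_eq0 fmorph_eq0 invr_eq0 intr_eq0.
  by rewrite (negPf a0).
exists (zprimitive q); split.
- by rewrite zcontents_primitive q0.
- rewrite size_zprimitive szq size_minPoly ltnS.
  have := dim_Fadjoin 1%AS x; rewrite dimv1 muln1 => <-.
  by apply: dimvS; exact: subvf.
- move: rq; rewrite [in root _ _](zpolyEprim q) map_polyZ rootZ //.
  by rewrite intr_eq0_ext zcontents_eq0.
Qed.

(** * Prime ideals *)

Section PrimeIdeal.
Context {K : fieldExtType rat} {P : K -> Prop}.
Context (hP : is_nonzero_prime_ideal P).
Implicit Types a b x y : K.

Lemma prime_alg_int {x} : P x -> is_alg_int x.
Proof. by case: hP => h *; exact: h. Qed.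

Lemma prime0 : P 0. Proof. by case: hP. Qed.

Lemma primeD x y : P x -> P y -> P (x + y).
Proof. by case: hP => _ _ h *; exact: h. Qed.

Lemma primeMl a x : is_alg_int a -> P x -> P (a * x).
Proof. by case: hP => _ _ _ h *; exact: h. Qed.

Lemma primeMr a x : is_alg_int a -> P x -> P (x * a).
Proof. by rewrite mulrC; exact: primeMl. Qed.

Lemma primeN x : P x -> P (- x).
Proof. by move=> Px; rewrite -mulN1r; apply: primeMl => //; exact: (alg_int_int (-1)). Qed.

Lemma primeB x y : P x -> P y -> P (x - y).
Proof. by move=> Px Py; apply: primeD => //; exact: primeN. Qed.

Lemma prime1 : ~ P 1. Proof. by case: hP => _ _ _ _ []. Qed.

Lemma primeM {a b} : is_alg_int a -> is_alg_int b -> P (a * b) -> P a \/ P b.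
Proof. by case: hP => _ _ _ _ [_ h _]; exact: h. Qed.

Lemma primeX a n : is_alg_int a -> P (a ^+ n) -> P a.
Proof.
move=> Oa; elim: n => [/prime1//|n IHn].
by rewrite exprS => /(primeM Oa (alg_intX n Oa)) [//|/IHn].
Qed.

Lemma prime_prod (I : eqType) (r : seq I) (Q : pred I) (G : I -> K) :
    (forall i, i \in r -> Q i -> is_alg_int (G i)) -> P (\prod_(i <- r | Q i) G i) ->
  exists i, [/\ i \in r, Q i & P (G i)].
Proof.
elim: r => [|i r IHr] OG; first by rewrite big_nil => /prime1.
have OGr j : j \in r -> Q j -> is_alg_int (G j) by move=> jr; apply: OG; rewrite inE jr orbT.
rewrite big_cons; case: ifP => Qi PG; last first.
  by have [j [jr Qj PGj]] := IHr OGr PG; exists j; rewrite inE jr orbT.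
have [PGi|/(IHr OGr)[j [jr Qj PGj]]] :=
    primeM (OG _ (mem_head _ _) Qi) (alg_int_prod OGr) PG.
  by exists i; rewrite mem_head.
by exists j; rewrite inE jr orbT.
Qed.

(** A substitute for reducing the product in the quotient by [P], which is never formed. *)
Lemma prime_sub1_prod (I : eqType) (r : seq I) (Q : pred I) (G : I -> K) :
  (forall i, i \in r -> Q i -> P (1 - G i)) -> P (1 - \prod_(i <- r | Q i) G i).
Proof.
move=> PG; rewrite big_seq_cond.
apply: (big_ind (fun x => P (1 - x))) => [|x y Px Py|i /andP[/PG]//].
  by rewrite subrr; exact: prime0.
have -> : 1 - x * y = (1 - x) + (1 - y) - (1 - x) * (1 - y) by ring.
by apply: primeB; [exact: primeD | apply: primeMl => //; exact: prime_alg_int].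
Qed.

Lemma prime_above_nat : exists2 p : nat, prime p & P p%:R.
Proof.
have [x Px x0] : exists2 x, P x & x != 0 by case: hP => _ _ _ _ [_ _ [x []]]; exists x.
have Ox := prime_alg_int Px.
have [z z0 Pz] : exists2 z : int, z != 0 & P z%:~R.
  have [q [cq _ rq]] := primitive_int_relation x.
  have {cq} q0 : q != 0 by apply: contra_eq_neq cq => ->; rewrite zcontents0.
  (* Factors ['X] are split off until the constant term is nonzero; being minus an integral multiple
     of [x], it lies in [P]. *)
  have [n] := ubnP (size q); elim: n q q0 rq => // n IHn q q0 rq szq.
  move: szq q0 rq; elim/poly_ind: q => [|q c _]; first by rewrite eqxx.
  have [-> | c0] := eqVneq c 0.
    rewrite addr0 mulf_eq0 polyX_eq0 orbF => szq q0.
    rewrite rmorphM /= map_polyX rootM rootX (negPf x0) orbF => rq.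
    by apply: (IHn q) => //; rewrite size_mulX // in szq.
  move=> _ _; rewrite rmorphD rmorphM /= map_polyX map_polyC /root !hornerE /=.
  move=> /eqP e; exists c => //.
  have -> : c%:~R = - ((map_poly intr q).[x] * x) by apply/eqP; rewrite -subr_eq0 opprK addrC e.
  by apply/primeN/primeMl => //; exact: alg_int_horner_int.
have {z z0 Pz} [n n0 Pn] : exists2 n : nat, (0 < n)%N & P n%:R.
  exists `|z|%N; first by rewrite absz_gt0.
  by move: Pz; case: z {z0} => n //; rewrite NegzE mulrNz => /primeN; rewrite opprK.
(* Descent: the least prime factor of [n] or its cofactor lies in [P]. *)
have [m] := ubnP n; elim: m n n0 Pn => // m IHm n n0 Pn lnm.
have [n1|n1] := leqP n 1.
  by have n_eq1 : n = 1%N by [apply/eqP; rewrite eqn_leq n1 n0]; case: prime1; rewrite n_eq1 in Pn.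
have pp := pdiv_prime n1.
have [Ppd|Pq] : P (pdiv n)%:R \/ P (n %/ pdiv n)%:R.
- apply: primeM; try exact: (alg_int_int (Posz _)).
  by rewrite -natrM mulnC divnK // pdiv_dvd.
- by exists (pdiv n).
apply: (IHm _ _ Pq); first by rewrite divn_gt0 ?prime_gt0 // dvdn_leq // pdiv_dvd.
by rewrite (leq_trans (ltn_Pdiv (prime_gt1 pp) n0)).
Qed.

(** By Bezout, an integer of [P] prime to [p] would put 1 in [P]. *)
Lemma prime_intE p (z : int) : prime p -> P p%:R -> P z%:~R <-> (p %| z)%Z.
Proof.
move=> pp Pp; split=> [Pz | /dvdzP[q ->]]; last first.
  by rewrite rmorphM /=; apply: primeMl => //; exact: alg_int_int.
apply: contrapT => /negP ndv; apply: prime1.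
have /coprimezP[[u v] /= e] : coprimez p z.
  by rewrite coprimezE prime_coprime.
rewrite -[1]/(1%:~R) -e rmorphD !rmorphM /=.
by apply: primeD; apply: primeMl => //; exact: alg_int_int.
Qed.

(** Nonzero primes are maximal. The inverse of [a] modulo [P] is an integer polynomial in [a], so
    that it stays in any subfield containing [a] and commutes with field morphisms. *)
Lemma prime_maximal a : is_alg_int a -> ~ P a ->
  exists q : {poly int}, P (1 - a * (map_poly intr q).[a]).
Proof.
move=> Oa nPa; have [p pp Pp] := prime_above_nat.
case: (Oa) => q [mq /rootP rq].
have {rq} : P (map_poly intr q).[a] by rewrite rq; exact: prime0.
have [n] := ubnP (size q); elim: n q mq => // n IHn q mq szq Pq.
move: szq mq Pq; elim/poly_ind: q => [|q c _].
  by rewrite monicE lead_coef0 eq_sym oner_eq0.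
rewrite rmorphD rmorphM /= map_polyX map_polyC !hornerE /= => szq mq Pq.
have [q0|q0] := eqVneq q 0.
  move: mq Pq; rewrite q0 rmorph0 horner0 mul0r !add0r monicE lead_coefC => /eqP->.
  by rewrite mulr1z mul0r add0r => /prime1.
have mq' : q \is monic.
  move: mq; rewrite !monicE lead_coefDl ?lead_coefMX //.
  by rewrite size_mulX // size_polyC; case: (c != 0); rewrite ltnS ?size_poly_gt0.
have szq' : (size q < n)%N.
  by move: szq; rewrite -cons_poly_def size_cons_poly /nilp size_poly_eq0 (negPf q0).
(* If [p] divides the constant term, [a] is cancelled modulo [P] and the degree drops; otherwise the
   constant term is inverted modulo [p]. *)
have [/(prime_intE _ pp Pp) Pc|ndv] := boolP (p %| c)%Z.
  have : P ((map_poly intr q).[a] * a).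
    by rewrite -[X in P X](addrK c%:~R); exact: primeB.
  by case/(primeM (alg_int_horner_int q Oa) Oa) => // Pq'; exact: (IHn q).
have /coprimezP[[u v] /= e] : coprimez p c by rewrite coprimezE prime_coprime.
exists (- v *: q); rewrite map_polyZ hornerZ.
have -> : 1 - a * (((- v)%:~R) * (map_poly intr q).[a]) =
   u%:~R * p%:R + v%:~R * ((map_poly intr q).[a] * a + c%:~R) :> K.
  have e1 : 1 = u%:~R * p%:R + v%:~R * c%:~R :> K.
    by rewrite -[LHS]/(1%:~R) -e rmorphD !rmorphM.
  by rewrite [X in X - _ = _]e1; ring.
by apply: primeD; apply: primeMl => //; exact: alg_int_int.
Qed.

(* Seidenberg's descent: an integral leading term [c = a_n x] is either outside [P],
   and then [x = c / a_n], or it can be absorbed in the next coefficient. *)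
Lemma prime_ratio x : x != 0 -> exists a s,
  [/\ is_alg_int a, is_alg_int s, s != 0, x = a / s & ~ P a \/ ~ P s].
Proof.
move=> x0; have [p pp Pp] := prime_above_nat.
have [q [cq _ rq]] := primitive_int_relation x.
have : exists n (c : nat -> K), [/\ forall i, is_alg_int (c i),
    exists2 i, (i <= n)%N & ~ P (c i) & \sum_(i < n.+1) c i * x ^+ i = 0].
  (* The bound [size q] exceeds the degree by one; the induction drops the resulting zero top
     coefficient. *)
  exists (size q), (fun i => (q`_i)%:~R); split=> [i||]; first exact: alg_int_int.
    have : ~ (forall i, q`_i \in dvdz p).
      move/polyOverP; rewrite -dvdz_contents cq dvdz1 absz_nat => /eqP p1.
      by rewrite p1 in pp.
    move/existsNP => [i /negP ndv]; exists i; last by move/(prime_intE _ pp Pp); apply/negP.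
    apply: contraR ndv; rewrite -ltnNge => /ltnW szi; rewrite nth_default //; exact: dvdz0.
  rewrite big_ord_recr /= [q`_(size q)]nth_default // mul0r addr0.
  rewrite -[RHS](rootP rq) (@horner_coef_wide _ (size q)) ?size_poly //.
  by apply: eq_bigr => i _; rewrite coef_map.
case=> n; elim: n => [|n IHn] [c [Oc [i lin nPi] e]].
  move: lin nPi e; rewrite leqn0 big_ord1 expr0 mulr1 => /eqP-> nP c0.
  by rewrite c0 in nP; case: nP; exact: prime0.
have Ocx := alg_int_leading Oc e.
have [c0|c0] := eqVneq (c n.+1) 0.
  move: e; rewrite big_ord_recr /= c0 mul0r addr0 => e; apply: IHn; exists c; split=> //.
  exists i => //; move: lin; rewrite leq_eqVlt => /predU1P[ei|//].
  by rewrite ei c0 in nPi; case: nPi; exact: prime0.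
have xE : x = c n.+1 * x / c n.+1 by rewrite mulrC mulKf.
have [Pcx|] := pselect (P (c n.+1 * x)); last by exists (c n.+1 * x), (c n.+1); split=> //; left.
have [Pc|] := pselect (P (c n.+1)); last by exists (c n.+1 * x), (c n.+1); split=> //; right.
apply: IHn; exists (fun j => if j == n then c n.+1 * x + c n else c j); split.
- by move=> j; case: eqP => // _; exact: alg_intD.
(* The index [i] is not [n.+1], whose coefficient is in [P]; if it is [n], adding an element of [P]
   keeps the coefficient outside [P]. *)
- exists i; first by move: lin; rewrite leq_eqVlt => /predU1P[ei|//]; rewrite ei in nPi.
  case: eqP => // ei; apply: contra_not nPi => /primeB/(_ Pcx).
  by rewrite addrAC subrr add0r ei.
- rewrite big_ord_recr /= eqxx mulrDl -mulrA -exprS addrCA addrC -[RHS]e !big_ord_recr /=.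
  congr (_ + _ + _); apply: eq_bigr => j _; case: eqP => // ej.
  by have := ltn_ord j; rewrite ej ltnn.
Qed.

End PrimeIdeal.

(** * Localization at a prime *)

(** Deliberately not normalized, so that a restriction to a subfield is again one even under
    ramification. The value at 0 is arbitrary, whence the nonvanishing conditions. *)
Definition adic_valuation (K : fieldType) (P : K -> Prop) (w : K -> int) : Prop :=
  [/\ forall x y, x != 0 -> y != 0 -> w (x * y) = w x + w y,
      forall x, is_alg_int x -> x != 0 -> 0 <= w x,
      forall x, is_alg_int x -> x != 0 -> P x <-> 0 < w x
    & forall x y, x != 0 -> y != 0 -> x + y != 0 -> w x <= w y -> w x <= w (x + y)].

Section Localization.
Context {K : fieldExtType rat} {P : K -> Prop}.
Context (hP : is_nonzero_prime_ideal P).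
Implicit Types a s x y : K.

Definition loc x := exists a s, [/\ is_alg_int a, is_alg_int s, ~ P s & x = a / s].
Definition loc_max x := exists a s, [/\ P a, is_alg_int s, ~ P s & x = a / s].
(** Since [0^-1 = 0], this also holds at 0; it means being a unit only for nonzero [x]. *)
Definition loc_unit x := loc x /\ loc x^-1.

Lemma notin_prime_neq0 s : ~ P s -> s != 0.
Proof. by apply: contra_not_neq => ->; exact: prime0 hP. Qed.

Lemma notin_primeM a s : is_alg_int a -> is_alg_int s -> ~ P a -> ~ P s -> ~ P (a * s).
Proof. by move=> Oa Os na ns /(primeM hP Oa Os)[]. Qed.

Lemma loc_alg_int x : is_alg_int x -> loc x.
Proof.
move=> Ox; exists x, 1; rewrite divr1; split=> //; [exact: alg_int1 | exact: prime1 hP].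
Qed.

Lemma loc1 : loc 1. Proof. exact/loc_alg_int/alg_int1. Qed.

Lemma locD x y : loc x -> loc y -> loc (x + y).
Proof.
move=> [a [s [Oa Os nPs ->]]] [b [t [Ob Ot nPt ->]]].
exists (a * t + b * s), (s * t); split.
- by apply: alg_intD; exact: alg_intM.
- exact: alg_intM.
- exact: notin_primeM.
- by rewrite addf_div ?notin_prime_neq0.
Qed.

Lemma locM x y : loc x -> loc y -> loc (x * y).
Proof.
move=> [a [s [Oa Os nPs ->]]] [b [t [Ob Ot nPt ->]]].
exists (a * b), (s * t); split; [exact: alg_intM.. | exact: notin_primeM | ].
by rewrite mulf_div.
Qed.

Lemma locX x n : loc x -> loc (x ^+ n).
Proof.
move=> lx; elim: n => [|n IHn]; first by rewrite expr0; exact: loc1.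
by rewrite exprS; exact: locM.
Qed.

Lemma loc_maxD x y : loc_max x -> loc_max y -> loc_max (x + y).
Proof.
move=> [a [s [Pa Os nPs ->]]] [b [t [Pb Ot nPt ->]]].
exists (a * t + b * s), (s * t); split.
- by apply: (primeD hP); apply: (primeMr hP).
- exact: alg_intM.
- exact: notin_primeM.
- by rewrite addf_div ?notin_prime_neq0.
Qed.

Lemma loc_max0 : loc_max 0.
Proof.
exists 0, 1; rewrite mul0r.
by split=> //; [exact: prime0 hP | exact: alg_int1 | exact: prime1 hP].
Qed.

Lemma loc_maxN1 : ~ loc_max (-1).
Proof.
move=> [a [s [Pa Os nPs e]]]; apply: (nPs).
have -> : s = - a by rewrite -[s]mul1r -[1]opprK e mulNr divfK ?notin_prime_neq0.
exact: primeN.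
Qed.

Lemma loc_max_or_unit x : loc x -> loc_max x \/ loc_unit x.
Proof.
move=> lx; case: (lx) => a [s [Oa Os nPs xE]].
have [Pa|nPa] := pselect (P a); first by left; exists a, s.
by right; split=> //; exists s, a; split=> //; rewrite xE invf_div.
Qed.

Lemma loc_total x : x != 0 -> loc x \/ loc x^-1.
Proof.
case/(prime_ratio hP) => a [s [Oa Os s0 -> [nPa|nPs]]]; last by left; exists a, s.
by right; exists s, a; rewrite invf_div.
Qed.

(** Rephrases membership in [P] through the local ring alone: if [x^-1 = a / s], then
    [s = a * x]. *)
Lemma prime_locV x : is_alg_int x -> x != 0 -> P x <-> ~ loc x^-1.
Proof.
move=> Ox x0; split=> [Px [a [s [Oa Os nPs e]]] | nl].
  apply: (nPs); have -> : s = a * x; last exact: primeMl.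
  have a0 : a != 0 by apply: contraNneq x0 => a0; rewrite -invr_eq0 e a0 mul0r.
  by rewrite -[x]invrK e invf_div mulrC divfK.
apply: contrapT => nPx; apply: nl; exists 1, x; split=> //; first exact: alg_int1.
by rewrite mul1r.
Qed.

Lemma loc_unit_notin s : is_alg_int s -> ~ P s -> loc_unit s.
Proof.
move=> Os nPs; split; first exact: loc_alg_int.
by apply: contrapT => /(prime_locV Os (notin_prime_neq0 nPs)).
Qed.

Lemma loc_unitM x y : loc_unit x -> loc_unit y -> loc_unit (x * y).
Proof. by move=> [lx lx'] [ly ly']; split; rewrite ?invfM; exact: locM. Qed.

Lemma loc_unitV x : loc_unit x -> loc_unit x^-1.
Proof. by case=> lx lx'; split; rewrite ?invrK. Qed.

Lemma loc_unitX x n : loc_unit x -> loc_unit (x ^+ n).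
Proof. by move=> [lx lx']; split; rewrite -?exprVn; exact: locX. Qed.

(** A valuation ring contains the roots of its elements: otherwise [x^-1] is local, and [x] is
    [x ^+ n.+1] times a power of it. *)
Lemma loc_exp x n : x != 0 -> loc (x ^+ n.+1) -> loc x.
Proof.
move=> x0 lxn; have [//|lx'] := loc_total x0.
have -> : x = x ^+ n.+1 * x^-1 ^+ n by rewrite exprS exprVn mulfK ?expf_neq0.
by apply: locM => //; exact: locX.
Qed.

(** Finds a term of least value before any valuation exists, comparing by divisibility in the local
    ring. *)
Lemma loc_divisor_min (I : eqType) (t : I -> K) (s : seq I) :
    (forall i, i \in s -> t i != 0) -> s != [::] ->
  exists2 i, i \in s & forall j, j \in s -> loc (t j / t i).
Proof.
elim: s => // i s IHs t0 _.
have ti0 := t0 _ (mem_head _ _).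
have [-> | s0] := eqVneq s [::].
  by exists i; rewrite ?mem_head // => j; rewrite !inE => /eqP->; rewrite divff //; exact: loc1.
have t0s j : j \in s -> t j != 0 by move=> js; rewrite t0 // inE js orbT.
have [k ks mk] := IHs t0s s0.
have tik : t k / t i != 0 by rewrite mulf_neq0 ?invr_eq0 ?(t0s k).
have [lik|] := loc_total tik.
  exists i; rewrite ?mem_head // => j; rewrite inE => /predU1P[->|/mk ljk].
    by rewrite divff //; exact: loc1.
  have -> : t j / t i = (t j / t k) * (t k / t i) by rewrite mulrA divfK ?t0s.
  exact: locM.
rewrite invf_div => lki; exists k; first by rewrite inE ks orbT.
by move=> j; rewrite inE => /predU1P[->|/mk].
Qed.

(* If all summands had different values, a dominant one could not be cancelled. *)
Lemma loc_unit_of_sum0 (I : eqType) (t : I -> K) (s : seq I) : uniq s ->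
    (forall i, i \in s -> t i != 0) -> s != [::] -> \sum_(i <- s) t i = 0 ->
  exists i j, [/\ i \in s, j \in s, i != j & loc_unit (t j / t i)].
Proof.
move=> us t0 s0 e; have [i si mi] := loc_divisor_min t0 s0.
apply: contrapT => nij; apply: loc_maxN1.
(* After division by the term of least value, the other terms sum to -1; were none a unit, -1 would
   lie in the maximal ideal. *)
have -> : -1 = \sum_(j <- s | j != i) t j / t i.
  apply/eqP; rewrite eq_sym -addr_eq0 addrC -{1}(divff (t0 _ si)).
  by rewrite -[X in _ + X]mulr_suml -mulrDl -bigD1_seq //= e mul0r.
rewrite big_seq_cond; apply: big_ind => [||j /andP[js ji]].
- exact: loc_max0.
- exact: loc_maxD.
- have [//|u] := loc_max_or_unit (mi j js).
  by case: nij; exists i, j; rewrite eq_sym.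
Qed.

(** * Values measured by powers of the residue characteristic *)

Section Valuation.
Context {p : nat} (pp : prime p) (Pp : P p%:R).

Lemma residue_char_neq0 : p%:R != 0 :> K.
Proof. by rewrite (intr_eq0_ext K p) -lt0n prime_gt0. Qed.

Lemma loc_unit_int (z : int) : z != 0 -> exists k : nat, loc_unit (z%:~R / p%:R ^+ k).
Proof.
move=> z0; have n0 : (0 < `|z|)%N by rewrite absz_gt0.
have [m cpm e] := pfactor_coprime pp n0; exists (logn p `|z|).
have -> : z%:~R = (sgz z)%:~R * m%:R * p%:R ^+ logn p `|z| :> K.
  by rewrite -mulrA -natrX -natrM -e {1}[z]intEsg rmorphM.
rewrite mulfK; last first.
  by rewrite expf_neq0 // residue_char_neq0.
apply: loc_unitM; last first.
  apply: loc_unit_notin; first exact: (alg_int_int m).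
  by move/(prime_intE hP m pp Pp); rewrite dvdzE /=; apply/negP; rewrite -prime_coprime.
case: sgzP z0 => // _ _; apply: loc_unit_notin; try exact: alg_int_int.
  exact: prime1 hP.
by move/(primeN hP); rewrite mulrN1z opprK; exact: prime1 hP.
Qed.

Let N := \dim {:K}.

(** Two terms of an integer relation for [x] have the same value, and integer coefficients have the
    values of powers of [p]. The degree bound gives [k <= N]. *)
Lemma loc_unit_power x : x != 0 ->
  exists2 k : nat, (0 < k <= N)%N & exists l : int, loc_unit (x ^+ k / p%:R ^ l).
Proof.
move=> x0; have [q [cq szq rq]] := primitive_int_relation x.
have q0 : q != 0 by apply: contra_eq_neq cq => ->; rewrite zcontents0.
pose s := [seq i <- iota 0 (size q) | q`_i != 0].
pose t i : K := (q`_i)%:~R * x ^+ i.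
have sP i : i \in s -> (i < size q)%N /\ q`_i != 0.
  by rewrite mem_filter mem_iota add0n => /andP[? /andP[_ ?]].
have t0 i : i \in s -> t i != 0.
  by case/sP => _ qi0; rewrite mulf_neq0 ?expf_neq0 ?intr_eq0_ext.
have s0 : s != [::].
  apply/eqP => s0; have : (size q).-1 \in s.
    by rewrite mem_filter -lead_coefE lead_coef_eq0 q0 mem_iota /= add0n prednK ?size_poly_gt0.
  by rewrite s0.
have us : uniq s by rewrite filter_uniq ?iota_uniq.
have st : \sum_(i <- s) t i = 0.
  rewrite big_filter -[RHS](rootP rq) (@horner_coef_wide _ (size q)) ?size_poly //.
  rewrite -(big_mkord xpredT (fun i => (map_poly intr q)`_i * x ^+ i)) /index_iota subn0.
  rewrite big_mkcond; apply: eq_bigr => i _; rewrite coef_map /=.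
  by case: ifPn => // /negPn/eqP->; rewrite mul0r.
have [i [j [si sj nij uij]]] := loc_unit_of_sum0 us t0 s0 st.
wlog ltij : i j si sj nij uij / (i < j)%N.
  move=> wl; have [lij|lji|eij] := ltngtP i j; first exact: (wl i j).
    by apply: (wl j i) => //; [rewrite eq_sym | rewrite -invf_div; exact: loc_unitV].
  by rewrite eij eqxx in nij.
have [_ qi0] := sP i si; have [szj qj0] := sP j sj.
have [k uk] := loc_unit_int qi0; have [l ul] := loc_unit_int qj0.
exists (j - i)%N; first by rewrite subn_gt0 ltij (leq_trans (leq_subr _ _)) // -ltnS (leq_trans szj).
(* Equal values of the terms [i] and [j] give [x ^+ (j - i)] the value of the ratio of coefficient
   [i] to coefficient [j]. *)
exists (k%:Z - l%:Z).
have pn0 := residue_char_neq0.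
have -> : x ^+ (j - i) / p%:R ^ (k%:Z - l%:Z) =
   (t j / t i) * ((q`_i)%:~R / p%:R ^+ k) * ((q`_j)%:~R / p%:R ^+ l)^-1.
  rewrite /t expfzDr // -invr_expz -!exprnP -(subnK (ltnW ltij)) addnK exprD.
  field; rewrite ?expf_neq0 ?intr_eq0_ext ?qi0 ?qj0 //.
  by rewrite subnK ?qj0 // ltnW.
by apply: loc_unitM; [exact: loc_unitM | exact: loc_unitV].
Qed.

Lemma loc_expz (l : int) : loc (p%:R ^ l) <-> 0 <= l.
Proof.
have pn0 := residue_char_neq0.
case: l => n; split=> //; first by move=> _; apply/locX/loc_alg_int/(alg_int_int p).
rewrite NegzE -invr_expz -exprnP -exprVn => /loc_exp; rewrite invr_eq0 => /(_ pn0) lp.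
by case: ((prime_locV (alg_int_int p) pn0).1 Pp).
Qed.

Lemma loc_unit_expz (l : int) : loc_unit (p%:R ^ l) -> l = 0.
Proof.
rewrite /loc_unit invr_expz => -[/loc_expz l0 /loc_expz l0'].
by apply/eqP; rewrite eq_le l0 -oppr_ge0 l0'.
Qed.

(** An exponent common to all [x] is what makes [l] additive in [x]. *)
Lemma loc_unit_power_fact x : x != 0 ->
  exists l : int, loc_unit (x ^+ N`! / p%:R ^ l).
Proof.
move=> x0; have [k /andP[k0 kN] [l ul]] := loc_unit_power x0.
have /dvdnP[m e] : (k %| N`!)%N by rewrite dvdn_fact // k0.
exists (l * m); rewrite e mulnC exprM -exprz_exp -exprnP -expr_div_n.
exact: loc_unitX.
Qed.

End Valuation.

(** The value [w x] is the exponent [l] above. Its uniqueness gives additivity; by extraction of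
    roots, [x] is local exactly when [w x] is nonnegative; closure of the local ring under sums
    gives the ultrametric inequality. *)
Lemma exists_adic_valuation : exists w, adic_valuation P w.
Proof.
have [p pp Pp] := prime_above_nat hP; have pn0 := residue_char_neq0 pp.
have /choice[w wP] x : exists l : int, x != 0 ->
    loc_unit (x ^+ (\dim {:K})`! / p%:R ^ l).
  have [->|x0] := eqVneq x 0; first by exists 0.
  by have [l ul] := loc_unit_power_fact pp Pp x0; exists l.
have wM x y : x != 0 -> y != 0 -> w (x * y) = w x + w y.
  move=> x0 y0; have xy0 : x * y != 0 by rewrite mulf_neq0.
  have u := loc_unitM (loc_unitM (wP x x0) (wP y y0)) (loc_unitV (wP _ xy0)).
  apply/eqP; rewrite -subr_eq0; apply/eqP/(loc_unit_expz pp Pp).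
  have fieldE (X Y a b c : K) : X != 0 -> Y != 0 -> a != 0 -> b != 0 -> c != 0 ->
      X / a * (Y / b) * (X * Y / c)^-1 = c * (a^-1 * b^-1).
    by move=> *; field; exact/and5P.
  move: u; rewrite exprMn fieldE ?expf_neq0 ?expfz_neq0 //.
  by rewrite !invr_expz -!expfzDr // -opprD.
have w1 : w 1 = 0.
  have := wM 1 1 (oner_neq0 _) (oner_neq0 _); rewrite mulr1 => /eqP.
  by rewrite -subr_eq subrr => /eqP.
have wV x : x != 0 -> w x^-1 = - w x.
  move=> x0; apply/eqP; rewrite -addr_eq0 addrC -wM ?invr_eq0 // divff //.
  by rewrite w1.
have wloc x : x != 0 -> loc x <-> 0 <= w x.
  move=> x0; have [u u'] := wP x x0.
  split=> [lx|/(loc_expz pp Pp) lp].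
    apply/(loc_expz pp Pp).
    have -> : p%:R ^ w x = x ^+ (\dim {:K})`! * (x ^+ (\dim {:K})`! / p%:R ^ w x)^-1.
      by rewrite invf_div mulrCA divff ?mulr1 // expf_neq0.
    by apply: locM => //; exact: locX.
  have := fact_gt0 (\dim {:K}); case: _`! u {u'} => // n u _.
  apply: (@loc_exp _ n) => //.
  by rewrite -[X in loc X](divfK (expfz_neq0 (w x) pn0)); exact: locM.
exists w; split=> //.
- by move=> x Ox x0; apply/(wloc x x0)/loc_alg_int.
- move=> x Ox x0; rewrite (prime_locV Ox x0) wloc ?invr_eq0 // wV // oppr_ge0 ltNge.
  by split=> /negP.
- move=> x y x0 y0 xy0 wxy.
  (* The inequality reduces to [1 + y / x] being local. *)
  have e : x + y = x * (1 + y / x) by rewrite mulrDr mulr1 mulrC divfK.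
  have n0 : 1 + y / x != 0 by apply: contraNneq xy0 => h; rewrite e h mulr0.
  rewrite e wM // lerDl; apply/(wloc _ n0)/locD; first exact: loc1.
  by apply/wloc; rewrite ?mulf_neq0 ?invr_eq0 // wM ?invr_eq0 // wV // subr_ge0.
Qed.

End Localization.

(** * Valuations and primes lying over *)

Section AdicValuation.
Context {K : fieldType} {P : K -> Prop} {w : K -> int}.
Context (wP : adic_valuation P w).
Implicit Types x y : K.

Lemma adicM x y : x != 0 -> y != 0 -> w (x * y) = w x + w y.
Proof. by case: wP => h *; exact: h. Qed.

Lemma val_ge0 x : is_alg_int x -> x != 0 -> 0 <= w x.
Proof. by case: wP => _ h *; exact: h. Qed.

Lemma val_gt0 x : is_alg_int x -> x != 0 -> P x <-> 0 < w x.
Proof. by case: wP => _ _ h *; exact: h. Qed.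

Lemma val_addW x y : x != 0 -> y != 0 -> x + y != 0 -> w x <= w y -> w x <= w (x + y).
Proof. by case: wP => _ _ _ h *; exact: h. Qed.

Lemma val_eq0 x : is_alg_int x -> x != 0 -> ~ P x -> w x = 0.
Proof.
move=> Ox x0 nPx; apply/eqP; rewrite eq_le val_ge0 // andbT leNgt.
by apply/negP => /(val_gt0 Ox x0).
Qed.

Lemma adic1 : w 1 = 0.
Proof.
have := adicM (oner_neq0 K) (oner_neq0 K); rewrite mulr1 => /eqP.
by rewrite -subr_eq subrr => /eqP.
Qed.

Lemma adicV x : x != 0 -> w x^-1 = - w x.
Proof.
move=> x0; apply/eqP; rewrite -addr_eq0 addrC -adicM ?invr_eq0 // divff //.
by rewrite adic1.
Qed.

Lemma adicX x n : x != 0 -> w (x ^+ n) = w x *+ n.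
Proof.
move=> x0; elim: n => [|n IHn]; first exact: adic1.
by rewrite exprS adicM ?expf_neq0 // IHn mulrS.
Qed.

Lemma adicN x : x != 0 -> w (- x) = w x.
Proof.
have N10 : -1 != 0 :> K by rewrite oppr_eq0 oner_eq0.
move=> x0; rewrite -mulN1r adicM //.
have : w (-1) + w (-1) = 0 by rewrite -adicM // mulrNN mulr1 adic1.
by rewrite -mulr2n => /eqP; rewrite mulrn_eq0 /= => /eqP->; rewrite add0r.
Qed.

Lemma adic_prod (I : eqType) (r : seq I) (G : I -> K) :
  (forall i, i \in r -> G i != 0) -> w (\prod_(i <- r) G i) = \sum_(i <- r) w (G i).
Proof.
move=> G0; rewrite big_seq [RHS]big_seq.
have [] : \prod_(i <- r | i \in r) G i != 0 /\
    w (\prod_(i <- r | i \in r) G i) = \sum_(i <- r | i \in r) w (G i); last by [].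
apply: (big_ind2 (fun x z => x != 0 /\ w x = z)) => [|x1 z1 x2 z2 [x10 <-] [x20 <-]|i /G0 //].
  by rewrite oner_neq0 adic1.
by rewrite mulf_neq0 // adicM.
Qed.

(** The strict ultrametric equality. The case [y = 0] is separate because [w 0] is unspecified. *)
Lemma val_addr x y : x != 0 -> y = 0 \/ w x < w y -> x + y != 0 /\ w (x + y) = w x.
Proof.
move=> x0 [->|ltxy]; first by rewrite addr0.
have [->|y0] := eqVneq y 0; first by rewrite addr0.
have xy0 : x + y != 0.
  by apply: contraTneq ltxy => /eqP; rewrite addr_eq0 => /eqP->; rewrite adicN // ltxx.
have Ny0 : - y != 0 by rewrite oppr_eq0.
split=> //; apply/eqP; rewrite eq_le (val_addW x0 y0 xy0 (ltW ltxy)) andbT leNgt.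
apply/negP => lt; have xE : (x + y) - y = x by rewrite addrK.
have [yxy|/ltW xyy] := leP (w y) (w (x + y)).
  have := val_addW Ny0 xy0; rewrite addrC xE adicN // => /(_ x0 yxy).
  by rewrite leNgt ltxy.
have := val_addW xy0 Ny0; rewrite xE adicN // => /(_ x0 xyy).
by rewrite leNgt lt.
Qed.

End AdicValuation.

(** Zorn's lemma on the ideals that contain [p] and contract into [P]: a maximal one is prime, and
    maximality of [P] forces it to contract onto [P]. *)
Lemma prime_lying_over (K L : fieldExtType rat) (phi : {rmorphism K -> L}) (P : K -> Prop) :
    is_nonzero_prime_ideal P ->
  exists2 Q : L -> Prop, is_nonzero_prime_ideal Q & forall x, Q (phi x) <-> P x.
Proof.
move=> hP; have [p pp Pp] := prime_above_nat hP.
pose ideal (I : set L) := [/\ forall x, I x -> is_alg_int x, I p%:R,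
  forall x y, I x -> I y -> I (x + y), forall a x, is_alg_int a -> I x -> I (a * x)
  & forall s, I (phi s) -> P s].
have [I [gI maxI]] : exists I, ((exists x, I x) -> ideal I) /\
    forall J, (I `<` J)%classic -> ~ ((exists x, J x) -> ideal J).
  apply: (@Zorn_bigcup L (fun I => (exists x, I x) -> ideal I)) => F FI totF [x0 [I0 FI0 I0x]].
  have idl I x : F I -> I x -> ideal I by move=> FI' Ix; apply: FI => //; exists x.
  have [_ pI0 _ _ _] := idl _ _ FI0 I0x.
  split=> [x [I FI' Ix]||x y [I FI' Ix] [J FJ Jy]|a x Oa [I FI' Ix]|s [I FI' Is]].
  - by have [h _ _ _ _] := idl _ _ FI' Ix; exact: h.
  - by exists I0.
  - have [sIJ|sJI] := totF I J FI' FJ.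
      by exists J => //; have [_ _ h _ _] := idl _ _ FJ Jy; apply: h => //; exact: sIJ.
    by exists I => //; have [_ _ h _ _] := idl _ _ FI' Ix; apply: h => //; exact: sJI.
  - by exists I => //; have [_ _ _ h _] := idl _ _ FI' Ix; exact: h.
  - by have [_ _ _ _ h] := idl _ _ FI' Is; exact: h.
have {maxI} maxI J : ideal J -> (I `<=` J)%classic -> (J `<=` I)%classic.
  move=> hJ sIJ; apply: contrapT => nJI; exact: (maxI J (conj sIJ nJI) (fun _ => hJ)).
have p0 : p%:R != 0 :> L by rewrite (intr_eq0_ext L p) -lt0n prime_gt0.
have idlI : ideal I.
  (* The ideal generated by [p] belongs to the family, hence a maximal member is not empty. *)
  apply: gI; pose J (x : L) := exists2 y, is_alg_int y & x = y * p%:R.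
  suff hJ : ideal J.
    apply: contrapT => /forallNP Ie; apply: (Ie p%:R); apply: (maxI J) => //; first by move=> x /Ie.
    by case: hJ.
  split.
  - by move=> x [y Oy ->]; apply: alg_intM => //; exact: (alg_int_int p).
  - by exists 1; [exact: alg_int1 | rewrite mul1r].
  - by move=> x y [x' Ox ->] [y' Oy ->]; exists (x' + y'); [exact: alg_intD | rewrite mulrDl].
  - by move=> a x Oa [x' Ox ->]; exists (a * x'); [exact: alg_intM | rewrite mulrA].
  - move=> s [y Oy e]; have -> : s = (s / p%:R) * p%:R.
      by rewrite divfK // (intr_eq0_ext K p) -lt0n prime_gt0.
    apply: (primeMl hP) => //; apply/(alg_int_rmorph phi).
    by rewrite rmorphM fmorphV rmorph_nat e mulfK.
have [I_int Ip ID IM IP] := idlI.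
(* By maximality of [I], adjoining [a] leaves the family of ideals lying over [P]. *)
have adj a : is_alg_int a -> ~ I a ->
    exists b s, [/\ is_alg_int b, ~ P s, is_alg_int s & I (phi s - b * a)].
  move=> Oa nIa; pose J (x : L) := exists2 b, is_alg_int b & I (x - b * a).
  apply: contrapT => nex; apply: nIa; apply: (maxI J); last 2 first.
  - by move=> x Ix; exists 0; [exact: alg_int0 | rewrite mul0r subr0].
  - exists 1; first exact: alg_int1.
    by rewrite mul1r subrr -(mul0r p%:R); apply: IM => //; exact: alg_int0.
  have J_int x : J x -> is_alg_int x.
    by case=> b Ob /I_int Oxb; rewrite -(subrK (b * a) x); apply: alg_intD => //; exact: alg_intM.
  split=> //.
  - by exists 0; [exact: alg_int0 | rewrite mul0r subr0].
  - move=> x y [b Ob Ib] [c Oc Ic]; exists (b + c); first exact: alg_intD.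
    by rewrite mulrDl opprD addrACA; exact: ID.
  - move=> c x Oc [b Ob Ib]; exists (c * b); first exact: alg_intM.
    by rewrite -mulrA -mulrBr; exact: IM.
  - move=> s Js; apply: contrapT => nPs; apply: nex; case: (Js) => b Ob Ib.
    by exists b, s; split=> //; apply/(alg_int_rmorph phi)/J_int.
have hI : is_nonzero_prime_ideal I.
  split=> //; first by rewrite -(mul0r p%:R); apply: IM => //; exact: alg_int0.
  split; last by exists p%:R.
    by rewrite -(rmorph1 phi) => /IP; exact: prime1 hP.
  move=> a b Oa Ob Iab; apply: contrapT => /not_orP[nIa nIb].
  have [c [s [Oc nPs Os Ics]]] := adj a Oa nIa;
  have [c' [t [Oc' nPt Ot Ict]]] := adj b Ob nIb.
  (* Modulo [I], [phi s] is [c * a] and [phi t] is [c' * b], so [phi (s * t)] is a multiple of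
     [a * b]. *)
  suff /IP/(primeM hP Os Ot)[] : I (phi (s * t)) by [].
  have -> : phi (s * t) = phi t * (phi s - c * a) + c * a * (phi t - c' * b) + c * c' * (a * b).
    by rewrite rmorphM; ring.
  apply: (ID); last by apply: IM => //; exact: alg_intM.
  apply: ID; first by apply: (IM) => //; apply/alg_int_rmorph.
  apply: (IM (c * a)) => //.
  exact: alg_intM.
exists I => // x; split=> [/IP//|Px]; have Ox := prime_alg_int hP Px.
apply: contrapT => nIx; have Opx : is_alg_int (phi x) by apply/alg_int_rmorph.
(* An inverse of [phi x] modulo [I] is a polynomial in [phi x], so it descends to [K] and puts 1 in
   [P]. *)
have [q Iq] := prime_maximal hI Opx nIx.
apply: (prime1 hP); rewrite -[1](subrK (x * (map_poly intr q).[x])).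
apply: (primeD hP); last by apply: (primeMr hP) => //; exact: alg_int_horner_int.
apply: IP; rewrite rmorphB rmorph1 rmorphM.
suff -> : phi (map_poly intr q).[x] = (map_poly intr q).[phi x] by [].
rewrite -horner_map -map_poly_comp; congr _.[_].
by apply: eq_map_poly => z; exact: rmorph_int.
Qed.

(** * Powers of a prime ideal *)

Lemma adic_valuation_comp (K L : fieldExtType rat) (phi : {rmorphism K -> L})
    (P : K -> Prop) (Q : L -> Prop) (w : L -> int) :
  (forall x, Q (phi x) <-> P x) -> adic_valuation Q w -> adic_valuation P (w \o phi).
Proof.
move=> QP wQ; split=> [x y x0 y0|x Ox x0|x Ox x0|x y x0 y0 xy0 lxy] /=.
- by rewrite rmorphM (adicM wQ) ?fmorph_eq0.
- by apply: (val_ge0 wQ); rewrite ?fmorph_eq0 // alg_int_rmorph.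
- by rewrite -QP; apply: (val_gt0 wQ); rewrite ?fmorph_eq0 // alg_int_rmorph.
- by rewrite rmorphD; apply: (val_addW wQ); rewrite -?rmorphD ?fmorph_eq0.
Qed.

Section IdealPow.
Context {K : fieldExtType rat} {P : K -> Prop}.
Context (hP : is_nonzero_prime_ideal P).
Implicit Types a s x y : K.

Lemma ideal_pow_alg_int n x : ideal_pow P n x -> is_alg_int x.
Proof.
elim: n x => //= n IHn x [r [rP ->]]; apply: alg_int_sum => q /rP[Pq /IHn Oq] _.
by apply: alg_intM => //; exact: prime_alg_int Pq.
Qed.

Lemma ideal_powD n x y : ideal_pow P n x -> ideal_pow P n y -> ideal_pow P n (x + y).
Proof.
case: n => /= [|n]; first exact: alg_intD.
move=> [r [rP ->]] [t [tP ->]]; exists (r ++ t); rewrite big_cat; split=> // q.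
by rewrite mem_cat => /orP[/rP|/tP].
Qed.

Lemma ideal_powMl n a x : is_alg_int a -> ideal_pow P n x -> ideal_pow P n (a * x).
Proof.
move=> Oa; case: n => /= [|n]; first exact: alg_intM.
move=> [r [rP ->]]; exists [seq (a * q.1, q.2) | q <- r]; split.
  by move=> _ /mapP[q /rP[Pq Pq2] ->]; split=> //; exact: (primeMl hP).
by rewrite big_map mulr_sumr; apply: eq_bigr => q _; rewrite mulrA.
Qed.

Lemma ideal_powSM n x y : P x -> ideal_pow P n y -> ideal_pow P n.+1 (x * y).
Proof.
move=> Px Py; exists [:: (x, y)]; rewrite big_seq1; split=> // q.
by rewrite inE => /eqP->.
Qed.

Lemma ideal_pow_sub n x : ideal_pow P n.+1 x -> ideal_pow P n x.
Proof.
move=> [r [rP ->]]; rewrite big_seq.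
apply: (big_ind (ideal_pow P n)) => [|x1 x2|q /rP[Pq Pq2]].
- by case: n {rP} => [|n]; [exact: alg_int0 | exists [::]; rewrite big_nil].
- exact: ideal_powD.
- by apply: ideal_powMl => //; exact: prime_alg_int Pq.
Qed.

(** Since [s] is invertible modulo [P], [y] is an element of [P] times [y] plus a multiple of
    [s * y]; the first summand gains one power at each induction step. *)
Lemma ideal_pow_cancel n s y : is_alg_int s -> ~ P s -> is_alg_int y ->
  ideal_pow P n (s * y) -> ideal_pow P n y.
Proof.
move=> Os nPs Oy; elim: n => // n IHn Psy.
have Py := IHn (ideal_pow_sub Psy).
have [q Pq] := prime_maximal hP Os nPs.
have -> : y = (1 - s * (map_poly intr q).[s]) * y + (map_poly intr q).[s] * (s * y) by ring.
apply: ideal_powD; first exact: ideal_powSM.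
by apply: ideal_powMl => //; exact: alg_int_horner_int.
Qed.

(** * The value group and the powers of the prime *)

Section Generator.
Context {w : K -> int} (wP : adic_valuation P w).

(** If the numerator is outside [P], its value is 0, and [0 <= w x] forces the denominator to be
    outside [P] as well. *)
Lemma val_ge0_ratio x : x != 0 -> 0 <= w x ->
  exists a s, [/\ is_alg_int a, is_alg_int s, a != 0, s != 0 & x = a / s /\ ~ P s].
Proof.
move=> x0 wx; have [a [s [Oa Os s0 xE nP]]] := prime_ratio hP x0.
have a0 : a != 0 by apply: contraNneq x0 => a0; rewrite xE a0 mul0r.
exists a, s; split=> //; split=> //; case: nP => // nPa /(val_gt0 wP Os s0).
apply/negP; rewrite -leNgt; move: wx.
by rewrite xE (adicM wP) ?invr_eq0 // (adicV wP) // (val_eq0 wP Oa a0 nPa) add0r oppr_ge0.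
Qed.

(** The least positive value [e] generates the value group; [u] is an integral uniformizer. *)
Lemma val_generator : exists (e : nat) (u : K),
  [/\ (0 < e)%N, P u, u != 0, w u = e & forall x, x != 0 -> (e %| w x)%Z].
Proof.
pose posval n := `[< (0 < n)%N /\ exists2 x, x != 0 & w x = n%:Z >].
have [p Pp p0] : exists2 x, P x & x != 0 by case: hP => _ _ _ _ [_ _ [x []]]; exists x.
have ex_pos : exists n, posval n.
  have wp := (val_gt0 wP (prime_alg_int hP Pp) p0).1 Pp.
  exists `|w p|%N; apply/asboolP; rewrite absz_gt0 gt_eqF //; split=> //.
  by exists p; rewrite ?gez0_abs // ltW.
have [e /asboolP[e0 [x x0 wx]] e_min] := ex_minnP ex_pos.
have [|a [s [Oa Os a0 s0 [xE nPs]]]] := val_ge0_ratio x0; first by rewrite wx.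
have wa : w a = e.
  by rewrite -wx xE (adicM wP) ?invr_eq0 // (adicV wP) // (val_eq0 wP Os s0 nPs) subr0.
exists e, a; split=> //; first by apply/(val_gt0 wP) => //; rewrite wa ltz_nat.
have valXz y (z : int) : y != 0 -> w (y ^ z) = w y * z.
  move=> y0; case: z => n; first by rewrite -exprnP (adicX wP) // -mulr_natr natz.
  rewrite NegzE -invr_expz (adicV wP) ?expf_neq0 // (adicX wP) // mulrN.
  by rewrite -mulr_natr natz.
move=> y y0; apply: contrapT => ndv.
(* Euclidean division: [z] has the remainder as its value, against the minimality of [e]. *)
pose q := (w y %/ e)%Z; pose z := y * a ^ (- q).
have z0 : z != 0 by rewrite mulf_neq0 // expfz_neq0.
have wz : w z = (w y %% e)%Z.
  by rewrite (adicM wP) ?expfz_neq0 // valXz // wa /modz mulrN [_ * q]mulrC.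
have eN0 : e%:Z != 0 by rewrite -lt0n.
have wz0 : 0 <= w z by rewrite wz modz_ge0.
have : (e <= `|w z|)%N.
  apply: e_min; apply/asboolP; split; last by exists z; rewrite ?gez0_abs.
  by rewrite absz_gt0 wz; apply/negP => /eqP/dvdz_mod0P.
by apply/negP; rewrite -ltnNge -ltz_nat gez0_abs // wz ltz_pmod.
Qed.

Context {e : nat} {u : K} (Pu : P u) (u0 : u != 0) (wu : w u = e) (e0 : (0 < e)%N).
Context (edv : forall x, x != 0 -> (e %| w x)%Z).

Lemma ideal_pow_val_ge n x : ideal_pow P n x -> x = 0 \/ e%:Z * n%:Z <= w x.
Proof.
have wP_ge y : P y -> y != 0 -> e%:Z <= w y.
  move=> Py y0; have /dvdzP[q wy] := edv y0.
  have := (val_gt0 wP (prime_alg_int hP Py) y0).1 Py.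
  by rewrite wy pmulr_lgt0 ?ltz_nat // => q0; rewrite ler_peMl // -gtz0_ge1.
elim: n x => [|n IHn] x /=.
  by have [->|x0] := eqVneq x 0; [left | right; rewrite mulr0; exact: (val_ge0 wP)].
move=> [r [rP ->]]; rewrite big_seq.
apply: (big_ind (fun x => x = 0 \/ e%:Z * n.+1%:Z <= w x)) => [|y z|[y z] /rP[/= Py]].
- by left.
- have [->|y0] := eqVneq y 0; first by rewrite add0r.
  have [->|z0] := eqVneq z 0; first by rewrite addr0.
  have [->|yz0] := eqVneq (y + z) 0; first by left.
  move=> [/eqP|wy]; first by rewrite (negPf y0).
  move=> [/eqP|wz]; first by rewrite (negPf z0).
  right; have [yz|/ltW zy] := leP (w y) (w z).
    exact: le_trans wy (val_addW wP y0 z0 yz0 yz).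
  by apply: (le_trans wz); rewrite addrC; apply: (val_addW wP); rewrite // addrC.
- have [->|y0] := eqVneq y 0; first by left; rewrite mul0r.
  have [->|z0] := eqVneq z 0; first by left; rewrite mulr0.
  case/IHn => [/eqP|wz]; first by rewrite (negPf z0).
  right; rewrite (adicM wP) // -addn1 PoszD mulrDr mulr1 addrC.
  by apply: lerD => //; exact: wP_ge.
Qed.

(** Writing [x / u ^+ n = a / s] with [s] outside [P] gives [s * x = a * u ^+ n], and [s] can be
    cancelled. *)
Lemma ideal_pow_of_val_ge n x : is_alg_int x -> x != 0 -> e%:Z * n%:Z <= w x -> ideal_pow P n x.
Proof.
move=> Ox x0 wx; have un0 : u ^+ n != 0 by rewrite expf_neq0.
have y0 : x / u ^+ n != 0 by rewrite mulf_neq0 ?invr_eq0.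
have [|a [s [Oa Os _ s0 [yE nPs]]]] := val_ge0_ratio y0.
  rewrite (adicM wP) ?invr_eq0 // (adicV wP) // (adicX wP) // wu.
  by rewrite -mulr_natr natz subr_ge0.
apply: (ideal_pow_cancel Os nPs Ox).
have -> : s * x = a * u ^+ n by rewrite -[x](divfK un0) yE mulrA mulrCA divff ?mulr1.
apply: ideal_powMl => //; elim: n {wx un0 y0 yE} => [|n IHn]; first exact: alg_int1.
by rewrite exprS; exact: ideal_powSM.
Qed.

(** The preceding bounds identify the nonzero elements of the [n]-th power of [P] as the integral
    ones of value at least [e * n]; hence [w] is [e] times the normalized valuation. *)
Lemma pval_eq_val x n : pval_eq P x n -> x != 0 -> w x = e%:Z * n%:Z.
Proof.
move=> [Px nPx] x0; have Ox := ideal_pow_alg_int Px.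
case: (ideal_pow_val_ge Px) => [/eqP|]; first by rewrite (negPf x0).
have /dvdzP[q wx] := edv x0; rewrite wx mulrC ler_pM2r ?ltz_nat // => nq.
congr (_ * _); apply/eqP; rewrite eq_le nq andbT leNgt; apply/negP => ltnq.
apply: nPx; apply: ideal_pow_of_val_ge => //.
by rewrite wx mulrC ler_pM2r ?ltz_nat // -addn1 PoszD -ltzD1 ltrD2r.
Qed.

End Generator.
End IdealPow.

(** * Decomposition group *)

Section Decomposition.
Context {L : splittingFieldType rat} {F E : {subfield L}} (galFE : galois F E).
Context {Q : L -> Prop} (hQ : is_nonzero_prime_ideal Q).
Implicit Types (x y : L) (g h : gal_of E).

(** One inclusion suffices: in a finite group, closure under products gives inverses. Only [x] in
    [E] is tested, where the action of [gal_of E] is meaningful. *)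
Definition decomp : {set gal_of E} :=
  [set g in 'Gal(E / F)%g | `[< forall x, x \in E -> Q x -> Q (g x) >]].

Lemma decompP g : reflect (g \in 'Gal(E / F)%g /\ forall x, x \in E -> Q x -> Q (g x))
  (g \in decomp).
Proof. by rewrite inE; apply: (iffP andP) => -[Gg /asboolP]. Qed.

Lemma decomp_group_set : group_set decomp.
Proof.
apply/group_setP; split; first by apply/decompP; split=> // x; rewrite gal_id.
move=> g h /decompP[Gg Qg] /decompP[Gh Qh]; apply/decompP; split; first exact: groupM.
by move=> x Ex Qx; rewrite galM //; apply: Qh; [exact: memv_gal | exact: Qg].
Qed.

Canonical decomp_group := Group decomp_group_set.

Lemma decomp_sub : (decomp \subset 'Gal(E / F))%g.
Proof. by apply/subsetP => g /decompP[]. Qed.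

Lemma decompN g : g \in 'Gal(E / F)%g -> g \notin decomp ->
  exists a, [/\ a \in E, is_alg_int a, ~ Q a & Q (g a)].
Proof.
move=> Gg nDg; have : (g^-1)%g \notin decomp by rewrite groupV.
rewrite inE groupV Gg /= => /asboolPn /existsNP[a] /not_implyP[Ea] /not_implyP[Qa nQa].
exists ((g^-1)%g a); split=> //; first exact: memv_gal.
  by apply/alg_int_rmorph; exact: prime_alg_int Qa.
by rewrite -galM // mulVg gal_id.
Qed.

(** Plays the role of the Chinese remainder theorem: [u] is 0 modulo [Q] and 1 modulo the other
    conjugates of [Q], while being fixed by [decomp]. *)
Lemma decomp_separating : exists u, [/\ u \in E, Q u,
    forall g, g \in decomp -> g u = u
  & forall g, g \in 'Gal(E / F)%g -> g \notin decomp -> Q (1 - g u)].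
Proof.
have /choice[c cP] (g : gal_of E) : exists a, g \in 'Gal(E / F)%g -> g \notin decomp ->
    [/\ a \in E, is_alg_int a, ~ Q a & Q (g a)].
  have [/andP[Gg nDg]|nG] := boolP ((g \in 'Gal(E / F)%g) && (g \notin decomp)).
    by have [a aP] := decompN Gg nDg; exists a.
  by exists 0 => Gg nDg; rewrite Gg nDg in nG.
pose R g := (g \in 'Gal(E / F)%g) && (g \notin decomp).
(* [b] is outside [Q], yet every [g] outside [decomp] sends it into [Q]. *)
pose b := \prod_(g | R g) c g.
have Eb : b \in E by apply: rpred_prod => g /andP[Gg nDg]; case: (cP g Gg nDg).
have Oc g : g \in index_enum _ -> R g -> is_alg_int (c g).
  by move=> _ /andP[Gg nDg]; case: (cP g Gg nDg).
have Ob : is_alg_int b by exact: alg_int_prod.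
have nQb : ~ Q b.
  by move/(prime_prod hQ Oc) => [g [_ /andP[Gg nDg]]]; case: (cP g Gg nDg).
have Qgb g : R g -> Q (g b).
  move=> Rg; rewrite rmorph_prod (bigD1 g) //=.
  case/andP: (Rg) => Gg nDg; apply: (primeMr hQ); last by case: (cP g Gg nDg).
  by apply: alg_int_prod => h hi /andP[Rh _]; apply/alg_int_rmorph; exact: Oc.
have [q Qq] := prime_maximal hQ Ob nQb.
set y := b * _ in Qq.
have Ey : y \in E.
  apply: rpredM => //; apply: rpred_horner => //.
  by apply/polyOverP => i; rewrite coef_map; exact: rpred_int.
have Oq := alg_int_horner_int q Ob.
have Qgy g : R g -> Q (g y).
  by move=> Rg; rewrite rmorphM; apply: (primeMr hQ); [apply/alg_int_rmorph | exact: Qgb].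
have E1y : 1 - y \in E by rewrite rpredB ?rpred1.
have O1y : is_alg_int (1 - y) := prime_alg_int hQ Qq.
(* [y] is 1 modulo [Q] and goes into [Q] under each [g] outside [decomp]; the product over [decomp]
   makes [1 - y] invariant. *)
exists (\prod_(g in decomp) g (1 - y)); split.
- by apply: rpred_prod => g _; exact: memv_gal.
- rewrite (bigD1 1%g) ?group1 //= gal_id; apply: (primeMr hQ) => //.
  by apply: alg_int_prod => g _ _; apply/alg_int_rmorph.
- move=> g Dg; rewrite rmorph_prod [RHS](reindex_inj (mulIg g)) /=.
  by apply: eq_big => [h|h _]; [rewrite groupMr | rewrite galM].
- move=> g Gg nDg; rewrite rmorph_prod /=; apply: (prime_sub1_prod hQ) => h _ Dh.
  rewrite -galM // rmorphB rmorph1 opprB addrCA subrr addr0; apply: Qgy.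
  apply/andP; split; first by rewrite groupM // (subsetP decomp_sub).
  by rewrite groupMl.
Qed.

Context {w : L -> int} (wQ : adic_valuation Q w).

(* [F] and the decomposition field have the same value group: [x] is corrected to an
   [x'] with the same value at [Q] whose other conjugates are all prime to [Q], and
   the norm of [x'] down to [F] does the job. *)
Lemma decomp_field_val x : x \in E -> is_alg_int x -> x != 0 ->
    (forall g, g \in decomp -> g x = x) ->
  exists c, [/\ c \in F, c != 0 & w c = w x].
Proof.
move=> Ex Ox x0 Dx; have [u [Eu Qu Du Gu]] := decomp_separating.
have Ou := prime_alg_int hQ Qu.
(* As [w u] is at least 1, this [M] gives the correction a value above [w x], unless it vanishes.
   Where [g u] is 1 modulo [Q], so is [g x']. *)
pose M := `|w x|.+1%N; pose x' := x + u ^+ M * (1 - x).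
have Ex' : x' \in E by rewrite rpredD ?rpredM ?rpredX ?rpredB ?rpred1.
have Ox' : is_alg_int x'.
  apply: alg_intD => //; apply: alg_intM; first exact: alg_intX.
  by apply: alg_intB => //; exact: alg_int1.
have [x'0 wx'] : x' != 0 /\ w x' = w x.
  apply: (val_addr wQ) => //.
  have [->|v0] := eqVneq (u ^+ M * (1 - x)) 0; [by left | right].
  move: v0; rewrite mulf_eq0 negb_or => /andP[uM0 x10].
  have u0 : u != 0 by move: uM0; rewrite expf_eq0.
  rewrite (adicM wQ) // (adicX wQ) //.
  have wu : 1 <= w u by rewrite -gtz0_ge1; apply/(val_gt0 wQ).
  have w1x : 0 <= w (1 - x) by apply: (val_ge0 wQ) => //; apply: alg_intB => //; exact: alg_int1.
  rewrite -[w x]addr0; apply: ltr_leD => //.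
  apply: (@lt_le_trans _ _ (1 *+ M)); last by rewrite lerMn2r wu orbT.
  by rewrite natz /M -[X in X < _]gez0_abs ?ltz_nat ?ltnS // (val_ge0 wQ).
have Dx' g : g \in decomp -> g x' = x'.
  by move=> Dg; rewrite rmorphD rmorphM rmorphXn rmorphB rmorph1 /= Du // Dx.
have Gx' g : g \in 'Gal(E / F)%g -> g \notin decomp -> Q (1 - g x').
  move=> Gg nDg; have -> : 1 - g x' = (1 - g x) * (1 - g u ^+ M).
    by rewrite rmorphD rmorphM rmorphXn rmorphB rmorph1 /=; ring.
  apply: (primeMl hQ).
    by apply: alg_intB; [exact: alg_int1 | apply/alg_int_rmorph].
  have -> : g u ^+ M = \prod_(i < M) g u by rewrite prodr_const card_ord.
  by apply: (prime_sub1_prod hQ) => i _ _; exact: Gu.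
have sFE : (F <= E)%VS by case/and3P: galFE.
have [r [rG ur rE]] := galois_factors sFE galFE x' Ex'.
set s := [seq _ | _ <- _] in ur rE.
have x's : x' \in s by have := root_minPoly F x'; rewrite rE root_prod_XsubC.
have s0 b : b \in s -> b != 0.
  by case/mapP => g _ ->; rewrite fmorph_eq0.
have cE : (minPoly F x').[0] = \prod_(b <- s) - b.
  by rewrite rE horner_prod; apply: eq_bigr => b _; rewrite !hornerE.
(* Up to sign, the product of the distinct conjugates of [x']; all but [x'] itself are 1 modulo [Q]
   and have value 0. *)
exists (minPoly F x').[0]; split.
- by apply: rpred_horner; [exact: minPolyOver | exact: rpred0].
- by rewrite cE prodf_seq_neq0; apply/allP => b /s0; rewrite oppr_eq0.
- rewrite cE (adic_prod wQ) => [|b /s0]; last by rewrite oppr_eq0.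
  rewrite (bigD1_seq x') //= (adicN wQ) // big_seq_cond big1 ?addr0 // => b /andP[bs bx'].
  rewrite (adicN wQ) ?s0 //; case/mapP: bs bx' => g gr -> gx'.
  have Gg : g \in 'Gal(E / F)%g by exact: (subsetP rG).
  have nDg : g \notin decomp by apply: contraNN gx' => /Dx'->.
  apply: (val_eq0 wQ); rewrite ?fmorph_eq0 //; first by apply/alg_int_rmorph.
  move=> Qg; apply: (prime1 hQ); rewrite -[1](subrK (g x')).
  by apply: (primeD hQ) => //; exact: Gx'.
Qed.

End Decomposition.

(** * The trinomial *)

Section Trinomial.
Context {L : fieldExtType rat} {n : nat} {a b : L}.
Let f : {poly L} := 'X^(n.+1) + a%:P * 'X^n + b%:P.

Lemma root_trinomial r : root f r = (r ^+ n * (r + a) == - b).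
Proof.
rewrite /root !hornerE -[RHS]subr_eq0 opprK mulrDr -exprSr.
by rewrite [r ^+ n * a]mulrC.
Qed.

Lemma size_trinomial : (0 < n)%N -> size f = n.+2.
Proof.
move=> n0; rewrite /f -addrA size_polyDl size_polyXn //.
rewrite (leq_ltn_trans (size_polyD _ _)) // gtn_max; apply/andP; split.
  by rewrite mul_polyC (leq_ltn_trans (size_scale_leq _ _)) // size_polyXn.
by rewrite (leq_ltn_trans (size_polyC_leq1 _)).
Qed.

Lemma monic_trinomial : (0 < n)%N -> f \is monic.
Proof.
move=> n0; rewrite monicE lead_coefE size_trinomial //= !coefD coefCM !coefXn coefC eqxx /=.
by rewrite gtn_eqF // mulr0 !addr0.
Qed.

Context (n0 : (0 < n)%N) (Oa : is_alg_int a) (Ob : is_alg_int b).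

Lemma trinomial_root_alg_int r : root f r -> is_alg_int r.
Proof.
move=> rf; apply: (alg_int_root_monic (monic_trinomial n0) rf) => i.
rewrite !coefD coefCM !coefXn coefC; apply: alg_intD; last first.
  by case: ifP => _ //; exact: alg_int0.
apply: alg_intD; first exact: (alg_int_int (i == n.+1)).
by apply: alg_intM => //; exact: (alg_int_int (i == n)).
Qed.

Context {Q : L -> Prop} (hQ : is_nonzero_prime_ideal Q) (Qb : Q b) (nQa : ~ Q a).

(** If all roots were in [Q], the value of [f] at 1, which is [1 + a + b], would be 1 modulo [Q],
    putting [a] in [Q]. *)
Lemma trinomial_root_outside_prime (rs : seq L) :
  f = \prod_(z <- rs) ('X - z%:P) -> exists2 r, root f r & ~ Q r.
Proof.
move=> fE; apply: contrapT => nex; apply: nQa.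
have Qrs z : z \in rs -> Q z.
  by move=> zrs; apply: contrapT => nQz; apply: nex; exists z; rewrite // fE root_prod_XsubC.
have : Q (1 - \prod_(z <- rs) (1 - z)).
  by apply: (prime_sub1_prod hQ) => z /Qrs Qz _; rewrite opprB addrCA subrr addr0.
have -> : \prod_(z <- rs) (1 - z) = f.[1].
  by rewrite fE horner_prod; apply: eq_bigr => z _; rewrite !hornerE.
rewrite !hornerE !expr1n mulr1 => Qf.
have -> : a = - (1 - (1 + a + b)) - b by ring.
by apply: (primeB hQ) => //; exact: (primeN hQ).
Qed.

Lemma trinomial_root_residue r : root f r -> ~ Q r -> Q (r + a).
Proof.
move=> rf nQr; have Or := trinomial_root_alg_int rf.
have : Q (r ^+ n * (r + a)) by move: rf; rewrite root_trinomial => /eqP->; exact: (primeN hQ).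
case/(primeM hQ (alg_intX n Or) (alg_intD Or Oa)) => //.
by move/(primeX hQ Or).
Qed.

(* [-a] is a simple root of [f] modulo [Q]. *)
Lemma trinomial_root_prime_uniq r s : root f r -> root f s -> ~ Q r -> ~ Q s -> r = s.
Proof.
move=> rf sf nQr nQs; have Or := trinomial_root_alg_int rf; have Os := trinomial_root_alg_int sf.
apply/eqP; apply: contraPT nQs => rs; apply.
(* [S] is the quotient of [r ^+ n - s ^+ n] by [r - s]. Subtracting the two root equations and
   cancelling [r - s] puts [s ^+ n] in [Q], because [r + a] is there. *)
pose S := \sum_(i < n) r ^+ (n.-1 - i) * s ^+ i.
have e : (r - s) * (S * (r + a) + s ^+ n) = 0.
  have := subrXX r s n; rewrite -/S => rsn.
  have -> : (r - s) * (S * (r + a) + s ^+ n) =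
     ((r - s) * S) * (r + a) + (r - s) * s ^+ n by ring.
  have -> : (r - s) * S = r ^+ n - s ^+ n by [].
  have -> : (r ^+ n - s ^+ n) * (r + a) + (r - s) * s ^+ n =
     r ^+ n * (r + a) - s ^+ n * (s + a) by ring.
  by move: rf sf; rewrite !root_trinomial => /eqP-> /eqP->; rewrite subrr.
apply: (primeX hQ (n := n)) => //.
move/eqP: e; rewrite mulf_eq0 subr_eq0 (negPf rs) /= addrC addr_eq0 => /eqP->.
apply/(primeN hQ)/(primeMl hQ); last exact: trinomial_root_residue.
by apply: alg_int_sum => i _ _; apply: alg_intM; exact: alg_intX.
Qed.

(** In [r ^+ n * (r + a) = - b] the factor [r + a] has value 0, as [r] is in [Q] and [a] is not. *)
Lemma trinomial_root_val (w : L -> int) r : adic_valuation Q w -> b != 0 ->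
  root f r -> Q r -> r != 0 /\ w r *+ n = w b.
Proof.
move=> wQ b0 rf Qr; have Or := trinomial_root_alg_int rf.
move: rf; rewrite root_trinomial => /eqP e.
have : r ^+ n * (r + a) != 0 by rewrite e oppr_eq0.
rewrite mulf_eq0 negb_or expf_eq0 n0 /= => /andP[r0 ra0]; split=> //.
rewrite -(adicN wQ b0) -e (adicM wQ) ?expf_neq0 // (adicX wQ) //.
rewrite (val_eq0 wQ (alg_intD Or Oa) ra0) ?addr0 // => Qra; apply: nQa.
have -> : a = (r + a) - r by ring.
exact: (primeB hQ).
Qed.

End Trinomial.

(** * Conjugacy of the roots, and the two transitivity statements *)

Lemma irreducible_minPoly (L : fieldExtType rat) (F : {subfield L})
    (f0 : {poly subvs_of F}) r s :
  irreducible_poly f0 -> root (map_poly vsval f0) r -> root (map_poly vsval f0) s ->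
  root (minPoly F r) s.
Proof.
move=> [_ irr] rf sf; have /polyOver_subvs[q qE] := minPolyOver F r.
(* The minimal polynomial of [r] divides the irreducible [f0], so the two are associate and share
   all roots. *)
have qf0 : q %| f0.
  rewrite -(dvdp_map (vsval : {rmorphism subvs_of F -> L})) -qE minPoly_dvdp //.
  by apply/polyOver_subvs; exists f0.
have sq1 : size q != 1.
  rewrite -(size_map_poly (vsval : {rmorphism subvs_of F -> L})) -qE size_minPoly.
  by rewrite eqSS -lt0n.
rewrite qE; move: (irr q sq1 qf0).
rewrite -(eqp_map (vsval : {rmorphism subvs_of F -> L})) => /eqp_root ->.
exact: sf.
Qed.

Lemma galois_splittingField_rat (L : splittingFieldType rat) (F E : {subfield L}) p :
  p \is a polyOver F -> splittingFieldFor F p E -> galois F E.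
Proof.
move=> Fp sp; have sFE : (F <= E)%VS by case: sp => rs _ <-; exact: subv_adjoin_seq.
apply/and3P; split=> //; last by apply/splitting_normalField => //; exists p.
apply/separableP => y _; apply/negPn/separablePn_pchar => -[q].
by rewrite inE /= (intr_eq0_ext L q) => /andP[/prime_gt0]; case: q.
Qed.

Theorem theorem4p1
  (Om : splittingFieldType rat) (F E : {subfield Om}) (d : nat)
  (A B : subvs_of F) (P : subvs_of F -> Prop) :
  let f0 : {poly subvs_of F} := 'X^d + A%:P * 'X^(d.-1) + B%:P in
  let f : {poly Om} := map_poly vsval f0 in
  (3 <= d)%N ->
  is_alg_int A -> is_alg_int B ->
  irreducible_poly f0 ->
  splittingFieldFor F f E ->
  is_nonzero_prime_ideal P -> P B -> ~ P A ->
  (exists n : nat, pval_eq P B n /\ coprime d.-1 n) ->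
  (exists2 H : {group gal_of E}, (H \subset 'Gal(E / F))%g &
     exists r0 : Om, [/\ root f r0,
        (forall h, h \in H -> h r0 = r0)
      & (forall r1 r2 : Om, root f r1 -> root f r2 -> r1 != r0 -> r2 != r0 ->
           exists2 h, h \in H & h r1 = r2)])
  /\
  (forall r1 r2 s1 s2 : Om, root f r1 -> root f r2 -> root f s1 -> root f s2 ->
     r1 != r2 -> s1 != s2 ->
     exists2 g, g \in 'Gal(E / F)%g & g r1 = s1 /\ g r2 = s2).
Proof.
case: d => [//|n] f0 f; rewrite ltnS /= => n2 OA OB irr spl hP PB nPA [v [pvB cop]].
have n0 : (0 < n)%N by exact: ltnW.
pose a := vsval A; pose b := vsval B.
have fE : f = 'X^(n.+1) + a%:P * 'X^n + b%:P.
  by rewrite /f /f0 !rmorphD rmorphM /= !map_polyXn !map_polyC.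
have fF : f \is a polyOver F by apply/polyOver_subvs; exists f0.
have galFE := galois_splittingField_rat fF spl.
have [sFE _ nFE] := and3P galFE.
have [rs frs rsE] : exists2 rs : seq Om, f = \prod_(z <- rs) ('X - z%:P) & {subset rs <= E}.
  case: spl => rs frs defE; exists rs; last first.
    by move=> z; rewrite -defE; exact: seqv_sub_adjoin.
  apply/eqP; move: frs; rewrite eqp_monic ?monic_prod_XsubC // fE.
  exact: monic_trinomial.
have rootE r : root f r -> r \in E by rewrite {1}frs root_prod_XsubC => /rsE.
have galroot g r : g \in 'Gal(E / F)%g -> root f r -> root f (g r).
  move=> Gg rf; have := rf; rewrite -(fmorph_root g) /= (fixedPoly_gal sFE Gg) //.
have [Q hQ QP] := prime_lying_over (vsval : {rmorphism subvs_of F -> Om}) hP.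
have [w wQ] := exists_adic_valuation hQ.
have wP := adic_valuation_comp QP wQ.
have [e [u [e0 Pu u0 wu edv]]] := val_generator hP wP.
(* Zero lies in every power of [P], so it has no finite valuation. *)
have B0 : B != 0.
  by apply/eqP => B0; case: pvB => _ []; rewrite B0; exists [::]; rewrite big_nil.
have wB : w b = e%:Z * v%:Z := pval_eq_val hP wP Pu u0 wu e0 edv pvB B0.
have Oa : is_alg_int a by apply/alg_int_rmorph.
have Ob : is_alg_int b by apply/alg_int_rmorph.
have Qb : Q b by apply/QP.
have nQa : ~ Q a by move/QP.
have b0 : b != 0 by rewrite fmorph_eq0.
have Oroot r : root f r -> is_alg_int r.
  by rewrite fE; exact: trinomial_root_alg_int.
have [r0 r0f nQr0] : exists2 r, root f r & ~ Q r.
  by rewrite fE in frs *; exact: trinomial_root_outside_prime frs.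
have rootQ r : root f r -> r != r0 -> Q r.
  move=> rf; apply: contra_neqP => nQr; rewrite fE in rf r0f.
  exact: (trinomial_root_prime_uniq n0 Oa Ob hQ Qb rf r0f nQr nQr0).
pose D := @decomp_group _ F E Q.
(* If [g] moved [r0], then [g r0] would lie in [Q], and [g^-1], also in [D], would bring [r0] into
   [Q]. *)
have Dr0 g : g \in D -> g r0 = r0.
  move=> /[dup] Dg /groupVr/decompP[Gg Qg]; have [Gg' _] := decompP _ Dg.
  apply: contrapT => /eqP gr0; apply: nQr0.
  have Er0 := rootE _ r0f.
  have -> : r0 = (g^-1)%g (g r0) by rewrite -galM // mulgV gal_id.
  by apply: Qg; [exact: memv_gal | apply: rootQ => //; exact: galroot].
have transD r1 r2 : root f r1 -> root f r2 -> r1 != r0 -> r2 != r0 ->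
    exists2 h, h \in D & h r1 = r2.
  move=> r1f r2f r10 r20; have Er1 := rootE _ r1f.
  (* The roots [s] of the minimal polynomial over the decomposition field [M] form the [D]-orbit of
     [r1]; [x] is their product up to sign. *)
  pose M := fixedField D.
  have sME : (M <= E)%VS by exact: capvSl.
  have [t [tD ut tE]] := galois_factors sME (fixedField_galois D) r1 Er1.
  rewrite gal_fixedField in tD; set s := [seq _ | _ <- _] in ut tE.
  have sP z : z \in s -> [/\ root f z, z != r0 & Q z].
    case/mapP => g gt zE; have Dg : g \in D by exact: (subsetP tD).
    have [Gg Qg] := decompP _ Dg.
    have zf : root f z by rewrite zE; exact: galroot.
    suff z0 : z != r0 by split=> //; exact: rootQ.
    by apply: contraNneq r10 => z0; apply/eqP; apply: (fmorph_inj g); rewrite /= -zE z0 Dr0.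
  pose x := (minPoly M r1).[0].
  have xE : x = \prod_(z <- s) - z.
    by rewrite /x tE horner_prod; apply: eq_bigr => z _; rewrite !hornerE.
  have Mx : x \in M by apply: rpred_horner; [exact: minPolyOver | exact: rpred0].
  have sval z : z \in s -> z != 0 /\ w z *+ n = w b.
    case/sP => zf _ Qz; rewrite fE in zf.
    exact: (trinomial_root_val n0 Oa Ob hQ nQa wQ b0 zf Qz).
  have x0 : x != 0.
    by rewrite xE prodf_seq_neq0; apply/allP => z /sval[]; rewrite oppr_eq0.
  have Ox : is_alg_int x.
    by rewrite xE; apply: alg_int_prod => z /sP[zf _ _] _; apply/alg_intN/Oroot.
  have [Ex Dx] := mem_fixedFieldP Mx.
  have [c [Fc c0 wc]] := decomp_field_val galFE hQ wQ Ex Ox x0 Dx.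
  (* The value of [x] is attained by some [c] in [F], where all values are multiples of [e]. *)
  have /dvdzP[k wxk] : (e %| w x)%Z.
    rewrite -wc; have := edv (vsproj F c); rewrite /= vsprojK //; apply.
    by rewrite -(fmorph_eq0 (vsval : {rmorphism subvs_of F -> Om})) /= vsprojK.
  have wxn : w x *+ n = w b *+ size s.
    rewrite xE (adic_prod wQ) => [|z /sval[]]; last by rewrite oppr_eq0.
    rewrite -sumrMnl big_seq (eq_bigr (fun=> w b)); last first.
      by move=> z /sval[z0 <-]; rewrite (adicN wQ).
    by rewrite -big_seq big_const_seq count_predT iter_addr_0.
  have ndvs : (n %| size s)%N.
    rewrite -(Gauss_dvdl _ cop); apply/dvdnP; exists `|k|%N.
    (* Cancelling [e] in [wxn]; coprimality of [n] and [v] then yields the divisibility. *)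
    have : k * n%:Z = v%:Z * (size s)%:Z.
      apply: (@mulfI _ e%:Z); first by rewrite -lt0n.
      move: wxn; rewrite wxk wB -[_ *+ n]mulr_natr -[_ *+ size s]mulr_natr !natz => wxn.
      by rewrite mulrA [RHS]mulrA -wxn [e%:Z * k]mulrC.
    by move/(congr1 absz); rewrite !abszM !absz_nat => ->; exact: mulnC.
  have s_gt0 : (0 < size s)%N.
    have : r1 \in s by have := root_minPoly M r1; rewrite tE root_prod_XsubC.
    by case: (s).
  have les := dvdn_leq s_gt0 ndvs.
  have r2s : r2 \in s.
    apply: contraT => r2s.
    have szf : size f = n.+2 by rewrite fE size_trinomial.
    have f_neq0 : f != 0 by rewrite -size_poly_eq0 szf.
    (* Together with the at least [n] roots in [s], [r0] and [r2] would make [n.+2] roots in degree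
       [n.+1]. *)
    suff /(max_poly_roots f_neq0) : all (root f) [:: r0, r2 & s].
      rewrite /= szf !ltnS ltnNge les; apply.
      rewrite inE eq_sym (negPf r20) r2s ut !andbT /=.
      by apply/negP => /sP[_ /eqP].
    by rewrite /= r0f r2f; apply/allP => z /sP[].
  case/mapP: r2s => h ht ->; exists h => //; exact: (subsetP tD).
have transG r s : root f r -> root f s -> exists2 g, g \in 'Gal(E / F)%g & g r = s.
  move=> rf sf; apply: normalField_root_minPoly => //; first exact: rootE.
  exact: irreducible_minPoly irr rf sf.
split.
  by exists D; [exact: decomp_sub | exists r0].
move=> r1 r2 s1 s2 r1f r2f s1f s2f r12 s12.
have [g1 Gg1 g1r] := transG _ _ r1f r0f; have [g2 Gg2 g2s] := transG _ _ s1f r0f.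
have g1r0 : g1 r2 != r0 by rewrite -g1r (inj_eq (fmorph_inj g1)) eq_sym.
have g2s0 : g2 s2 != r0 by rewrite -g2s (inj_eq (fmorph_inj g2)) eq_sym.
have [h Dh hE] := transD _ _ (galroot _ _ Gg1 r2f) (galroot _ _ Gg2 s2f) g1r0 g2s0.
(* Products act from left to right: [g1] moves [r1] to [r0], [h] fixes [r0] and matches the second
   roots, and [g2^-1] carries [r0] to [s1]. *)
exists (g1 * h * g2^-1)%g.
  by rewrite !groupM ?groupV // (subsetP decomp_sub _ Dh).
have Er1 := rootE _ r1f; have Er2 := rootE _ r2f.
have Es1 := rootE _ s1f; have Es2 := rootE _ s2f.
rewrite !galM ?memv_gal // hE g1r Dr0 //; split.
  by rewrite -g2s -galM // mulgV gal_id.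
by rewrite -galM // mulgV gal_id.
Qed.
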